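(* Let $f:\{0,1\}^5\to\{0,1\}$ be a radius-$2$ cellular automaton local rule with induced global rule $F$. For $L\ge5$ let $$E_L=\begin{cases}\{1^L\}, & L\text{ odd};\\ \{1^L,(10)^{L/2},(01)^{L/2}\}, & L=4p+2\text{ for some integer }p\ge1;\\ \{1^L,(10)^{L/2},(01)^{L/2},(1100)^{L/4},(1001)^{L/4},(0011)^{L/4},(0110)^{L/4}\}, & L=4p\text{ for some integer }p\ge2.\end{cases}$$ Suppose there are integers $n_1\ge1$ and $n_2\ge1$ such that the following properties hold for every $L\ge5$: C1) for every $c\in\mathscr{C}_L$ with $c\notin E_L$ there is $0\le j\le L-1$ with $(F^{n_1}(c))_{[j,j+2]}=000$; C2) there is $0\le i\le L-1$ such that, for every $c\in\mathscr{C}_L$ and every $0\le j\le L-1$, if $c_{[j,j+2]}=000$ then $(F^{n_2}(c))_{[i+j,i+j+3]}=0000$; C3) $f(0,1,0,1,0)=f(1,0,1,0,1)=f(1,1,1,1,1)=f(1,1,0,0,1)=f(0,0,1,1,0)=1$; C4) $f(0,0,0,0,0)=f(0,1,1,0,0)=f(1,0,0,1,1)=0$. Then $f$ is a consensus rule and $\mathscr{B}_1^L=E_L$ for every $L\ge5$.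
   Context: A radius-$2$ (binary, one-dimensional) cellular automaton local rule is a function $f:\{0,1\}^{5}\to\{0,1\}$. A configuration of length $L$ is a cyclic word $c=(c_0,\dots,c_{L-1})\in\{0,1\}^L=:\mathscr{C}_L$, with cell indices taken modulo $L$; $c_{[a,b]}=c_ac_{a+1}\cdots c_b$. The induced global rule $F:\mathscr{C}_L\to\mathscr{C}_L$ is $(F(c))_p=f(c_{p-2},c_{p-1},c_p,c_{p+1},c_{p+2})$, and $F^n$ is its $n$-th iterate. For a block $b$, $b^n$ denotes the concatenation of $n$ copies of $b$. An attractor of length $L$ of $F$ is a nonempty set $X\subseteq\mathscr{C}_L$ with $F(X)=X$ such that any nonempty $Y\subseteq X$ with $F(Y)=Y$ equals $X$ (i.e. a periodic orbit); if $X=\{x\}$ it is a fixed point and is identified with $x$. The basin of attraction of $X$ is $\{c\in\mathscr{C}_L: F^t(c)\in X\text{ for some }t\ge0\}$; $\mathscr{B}^L_x$ denotes the basin of attraction of $x^L$ for $x\in\{0,1\}$. The rule $f$ is a consensus rule if for every $L\ge5$ its only attractors of length $L$ are $0^L$ and $1^L$ (both being attractors). *)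

(* Defs.v *)
From HB Require Import structures.
From mathcomp Require Import all_boot all_order all_algebra.

Set Implicit Arguments.
Unset Strict Implicit.
Unset Printing Implicit Defensive.

Import GRing.Theory.

Definition local_rule := bool -> bool -> bool -> bool -> bool -> bool.

Definition config (L : nat) := L.-tuple bool.

(* Cell indices are integers read modulo [L]; for [0 < L] the remainder lies in
   [0, L), so the default value of [nth] is never used. *)
Definition cell (L : nat) (c : config L) (p : int) : bool :=
  nth false c `|(p %% L%:Z)%Z|%N.

(* The factor $c_{[a,b]}$, both endpoints included, read cyclically. *)
Definition factor (L : nat) (c : config L) (a b : nat) : seq bool :=
  [seq cell c k%:Z | k <- iota a (b.+1 - a)].

Definition global_rule (f : local_rule) (L : nat) (c : config L) : config L :=
  [tuple f (cell c (p%:Z - 2)%R) (cell c (p%:Z - 1)%R) (cell c p%:Z)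
           (cell c (p%:Z + 1)%R) (cell c (p%:Z + 2)%R) | p < L].
Arguments global_rule f {L} c.

Definition wpow (b : seq bool) (n : nat) : seq bool := flatten (nseq n b).

Definition uniform (L : nat) (x : bool) : config L := [tuple of nseq L x].

Definition attractor (f : local_rule) (L : nat) (X : {set config L}) : Prop :=
  [/\ X != set0,
      global_rule f @: X = X &
      forall Y : {set config L},
        Y != set0 -> Y \subset X -> global_rule f @: Y = Y -> Y = X].

Definition basin (f : local_rule) (L : nat) (X : {set config L})
    (c : config L) : Prop :=
  exists t : nat, iter t (global_rule f) c \in X.

Definition consensus_rule (f : local_rule) : Prop :=
  forall L : nat, 5 <= L -> forall X : {set config L},
    attractor f X <-> X = [set uniform L false] \/ X = [set uniform L true].

Definition E_words (L : nat) : seq (seq bool) :=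
  let one := wpow [:: true] L in
  let alt := [:: wpow [:: true; false] (L %/ 2);
                 wpow [:: false; true] (L %/ 2)] in
  if odd L then [:: one]
  else if L %% 4 == 2 then one :: alt
  else one :: alt ++ [:: wpow [:: true; true; false; false] (L %/ 4);
                         wpow [:: true; false; false; true] (L %/ 4);
                         wpow [:: false; false; true; true] (L %/ 4);
                         wpow [:: false; true; true; false] (L %/ 4)].

Definition E (L : nat) : {set config L} :=
  [set c : config L | tval c \in E_words L].

(* Main.v *)
(* A word periodic of period [m] evolves like a configuration of length [m], so
   the words of [E L] reach [1^L] in at most two steps, by a computation on
   cycles of length 1, 2 and 4. Outside [E L], C1 produces a run of three zeros
   and each application of [F^n2] lengthens the longest run by one cell: a run
   of length [m] is covered by [m - 2] overlapping runs of length three, and C2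
   shifts all of them by the same [i]. After [L] rounds the run covers the
   whole cycle. *)
Require Import Defs.
From mathcomp Require Import all_boot all_order all_algebra.
From mathcomp Require Import zify.

Lemma cell_modz {L : nat} (c : config L) (p : int) :
  cell c (p %% L%:Z)%Z = cell c p.
Proof. by rewrite /cell modz_mod. Qed.

Lemma cell_nat {L : nat} (c : config L) (k : nat) :
  cell c k%:Z = nth false c (k %% L).
Proof. by rewrite /cell modz_nat. Qed.

Lemma cell_inj {L : nat} (c d : config L) :
  (forall k, k < L -> cell c k%:Z = cell d k%:Z) -> c = d.
Proof.
move=> eq_cd; apply/val_inj/(@eq_from_nth _ false); first by rewrite !size_tuple.
move=> k; rewrite size_tuple => lt_kL.
by have := eq_cd k lt_kL; rewrite !cell_nat modn_small.
Qed.

(** The tuple is indexed by representatives below [L], but the neighbours of [p] and of its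
    representative agree modulo [L], so the formula extends to every integer. *)
Lemma cell_global_rule (f : local_rule) {L : nat} (c : config L) (p : int) :
  0 < L ->
  cell (global_rule f c) p =
    f (cell c (p - 2)%R) (cell c (p - 1)%R) (cell c p)
      (cell c (p + 1)%R) (cell c (p + 2)%R).
Proof.
move=> L_gt0.
have lt_pL : `|(p %% L%:Z)%Z|%N < L by lia.
have -> : cell (global_rule f c) p = tnth (global_rule f c) (Ordinal lt_pL).
  by rewrite /cell (tnth_nth false).
rewrite tnth_mktuple /=.
have -> : (`|(p %% L%:Z)%Z|%N : int) = (p %% L%:Z)%Z by lia.
have modE q : cell c ((p %% L%:Z)%Z + q)%R = cell c (p + q)%R.
  by rewrite -cell_modz modzDml cell_modz.
by rewrite cell_modz !modE.
Qed.

Lemma size_wpow (w : seq bool) (n : nat) : size (wpow w n) = n * size w.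
Proof. by rewrite /wpow size_flatten /shape map_nseq sumn_nseq mulnC. Qed.

Lemma nth_wpow (w : seq bool) (n k : nat) :
  k < n * size w -> nth false (wpow w n) k = nth false w (k %% size w).
Proof.
elim: n k => [//|n IHn] k; rewrite mulSn /wpow /= nth_cat => lt_k.
have [lt_kw|le_wk] := ltnP k (size w); first by rewrite modn_small.
rewrite [LHS]IHn; last by lia.
by rewrite -[in RHS](subnK le_wk) modnDr.
Qed.

Lemma wpow_nseq (x : bool) (m n : nat) : wpow (nseq m x) n = nseq (n * m) x.
Proof.
by elim: n => //= n IHn; rewrite mulSn nseqD -IHn.
Qed.

(** Since [m] divides [L], reducing modulo [L] and then modulo [m] is reducing modulo [m]. Negative
    [p] matter: neighbourhoods reach left of cell 0. *)
Lemma cell_wpow {L m : nat} (c : config L) (w : config m) (n : nat) (p : int) :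
  0 < L -> tval c = wpow w n -> cell c p = cell w p.
Proof.
move=> L_gt0 def_c; have def_L : L = n * m.
  by rewrite -(size_tuple c) def_c size_wpow size_tuple.
rewrite /cell def_c nth_wpow size_tuple; last by rewrite -def_L; lia.
congr nth; have -> : (p %% m%:Z)%Z = ((p %% L%:Z)%Z %% m%:Z)%Z.
  rewrite def_L {1}(divz_eq p (n * m)%N%:Z).
  by rewrite [X in (_ * X + _)%R]PoszM GRing.mulrA modzMDl.
by rewrite -[in RHS](@gez0_abs (p %% L%:Z)%Z) ?modz_nat //; lia.
Qed.

(** Corresponding neighbourhoods in [c] and [w] agree, even for [m < 5], where a neighbourhood wraps
    around [w]. *)
Lemma global_rule_wpow (f : local_rule) {L m : nat}
    (c : config L) (w : config m) (n : nat) :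
  0 < L -> tval c = wpow w n ->
  tval (global_rule f c) = wpow (global_rule f w) n.
Proof.
move=> L_gt0 def_c; have def_L : L = n * m.
  by rewrite -(size_tuple c) def_c size_wpow size_tuple.
have m_gt0 : 0 < m by move: L_gt0; rewrite def_L muln_gt0 => /andP[].
have sz : size (wpow (global_rule f w) n) == L.
  by rewrite size_wpow size_tuple def_L.
suff -> : global_rule f c = Tuple sz by [].
apply: cell_inj => k _; rewrite (@cell_wpow _ _ (Tuple sz) (global_rule f w) n) //.
by rewrite !cell_global_rule // !(@cell_wpow _ _ c w n).
Qed.

Lemma iter_global_rule_wpow (f : local_rule) {L m : nat}
    (c : config L) (w : config m) (n t : nat) :
  0 < L -> tval c = wpow w n ->
  tval (iter t (global_rule f) c) = wpow (iter t (global_rule f) w) n.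
Proof. by move=> L_gt0 def_c; elim: t => //= t; apply: global_rule_wpow. Qed.

Lemma global_rule_uniform {f : local_rule} {L : nat} {x : bool} :
  0 < L -> f x x x x x = x -> global_rule f (uniform L x) = uniform L x.
Proof.
move=> L_gt0 fx; have cellx p : cell (uniform L x) p = x.
  by rewrite /cell /= nth_nseq; case: ifP => //; lia.
by apply: cell_inj => k _; rewrite cell_global_rule // !cellx.
Qed.

Lemma uniform_inj {L : nat} : 0 < L -> injective (uniform L).
Proof. by case: L => // L _ x y /(congr1 val) [->]. Qed.

Section ZeroRuns.

Context {L : nat}.
Implicit Types c : config L.

(** Neither [j] nor [k] is bounded by [L]: a run may drift around the cycle and overlap itself, so
    its growth needs no boundary case. *)
Definition zero_run c (j k : nat) : Prop :=
  forall d, d < k -> cell c (j + d)%:Z = false.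

Lemma factor_zero_run c (j k : nat) :
  factor c j (j + k) = nseq k.+1 false <-> zero_run c j k.+1.
Proof.
have sz : size (factor c j (j + k)) = k.+1.
  by rewrite size_map size_iota -addnS addKn.
have nth_c d : d < k.+1 -> nth false (factor c j (j + k)) d = cell c (j + d)%:Z.
  by move=> lt_d; rewrite /factor -addnS addKn (nth_map 0) ?size_iota ?nth_iota.
split=> [eq_c d lt_d|run_c]; first by rewrite -nth_c // eq_c nth_nseq lt_d.
apply: (@eq_from_nth _ false); first by rewrite sz size_nseq.
by move=> d; rewrite sz => lt_d; rewrite nth_nseq lt_d nth_c ?run_c.
Qed.

(** Reconciles drifting runs with C2, which only speaks of starting cells below [L]. *)
Lemma zero_run_modn c (i j k : nat) :
  zero_run c (i + j %% L) k <-> zero_run c (i + j) k.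
Proof.
have eq_cell d : cell c (i + j %% L + d)%:Z = cell c (i + j + d)%:Z.
  by rewrite !cell_nat addnAC modnDmr addnAC.
by split=> run_c d /run_c; rewrite eq_cell.
Qed.

Lemma zero_run_full c (j k : nat) :
  L <= k -> zero_run c j k -> c = uniform L false.
Proof.
move=> le_Lk run_c; apply: cell_inj => p lt_pL.
have L_gt0 : 0 < L by apply: leq_ltn_trans lt_pL.
(* This offset is [p - j] modulo [L], written so that the natural subtraction does not truncate. *)
have lt_d : (p + (L - j %% L)) %% L < k.
  by apply: leq_trans le_Lk; rewrite ltn_mod.
have := run_c _ lt_d; rewrite !cell_nat modnDmr.
have -> : (j + (p + (L - j %% L))) %% L = p %% L.
  rewrite -modnDml addnCA subnKC ?modnDr //.
  by rewrite ltnW // ltn_mod.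
by move=> ->; rewrite /= nth_nseq if_same.
Qed.

Lemma zero_run_grow (G : config L -> config L) (i : nat) :
    (forall c j, zero_run c j 3 -> zero_run (G c) (i + j) 4) ->
  forall m c j, zero_run c j 3 -> zero_run (iter m G c) (m * i + j) (m + 3).
Proof.
move=> growG m c j run_c; elim: m => [//|m IHm] d lt_d.
(* Cell [d] of the new run comes from the three zeros at offset [e] of the old one: [e <= m] keeps
   them inside its [m + 3] cells, and [d - e < 4] puts the cell among their four image zeros. *)
pose e := minn d m.
have -> : m.+1 * i + j + d = i + (m * i + j + e) + (d - e) by rewrite mulSn; lia.
rewrite iterS; apply: growG; last by lia.
by move=> d' lt_d'; rewrite -addnA IHm //; lia.
Qed.

End ZeroRuns.

(** Both limits are fixed, so after [t + s] steps the orbit sits at both. *)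
Lemma uniform_limit_unique {f : local_rule} {L t s : nat} {x y : bool}
    {c : config L} :
  0 < L -> f x x x x x = x -> f y y y y y = y ->
  iter t (global_rule f) c = uniform L x ->
  iter s (global_rule f) c = uniform L y -> x = y.
Proof.
move=> L_gt0 fx fy c_x c_y; apply: (uniform_inj L_gt0).
rewrite -(iter_fix s (global_rule_uniform L_gt0 fx)) -c_x.
by rewrite -iterD addnC iterD c_y iter_fix // global_rule_uniform.
Qed.

Lemma attractor_set1 {f : local_rule} {L : nat} {x : config L} :
  global_rule f x = x -> attractor f [set x].
Proof.
move=> fx; split; first by apply/set0Pn; exists x; rewrite set11.
  by rewrite imset_set1 fx.
by move=> Y Y_neq0 + _; rewrite subset1 (negPf Y_neq0) orbF => /eqP.
Qed.

(** Invariance keeps the orbit of [c] in [X], so [[set x]] is an invariant subset and minimality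
    applies. *)
Lemma attractor_fixpoint {f : local_rule} {L : nat} {X : {set config L}}
    {x c : config L} {t : nat} :
  attractor f X -> c \in X -> iter t (global_rule f) c = x ->
  global_rule f x = x -> X = [set x].
Proof.
move=> [_ FX minX] cX <- fx; apply/esym/minX.
- by apply/set0Pn; exists (iter t (global_rule f) c); rewrite set11.
- rewrite sub1set; elim: (t) => //= s IHs.
  by rewrite -FX imset_f.
- by rewrite imset_set1 fx.
Qed.

Theorem corollary8 (f : local_rule) (n1 n2 : nat)
  (hn1 : 1 <= n1) (hn2 : 1 <= n2)
  (C1 : forall L : nat, 5 <= L ->
     forall c : config L, c \notin E L ->
     exists2 j : nat, j < L &
       factor (iter n1 (global_rule f) c) j (j + 2)
         = [:: false; false; false])
  (C2 : forall L : nat, 5 <= L ->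
     exists2 i : nat, i < L &
       forall (c : config L) (j : nat), j < L ->
         factor c j (j + 2) = [:: false; false; false] ->
         factor (iter n2 (global_rule f) c) (i + j) (i + j + 3)
           = [:: false; false; false; false])
  (C3 : [/\ f false true false true false = true,
            f true false true false true = true,
            f true true true true true = true,
            f true true false false true = true &
            f false false true true false = true])
  (C4 : [/\ f false false false false false = false,
            f false true true false false = false &
            f true false false true true = false]) :
  consensus_rule f /\
  (forall (L : nat), 5 <= L ->
     forall c : config L, basin f [set uniform L true] c <-> c \in E L).
Proof.
case: C3 => f01010 f10101 f11111 f11001 f00110.
case: C4 => f00000 f01100 f10011.
have fix1 L : 0 < L -> global_rule f (uniform L true) = uniform L true.
  by move=> L_gt0; apply: global_rule_uniform.
have fix0 L : 0 < L -> global_rule f (uniform L false) = uniform L false.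
  by move=> L_gt0; apply: global_rule_uniform.
(* Two steps serve all words: those of period 1 or 2 reach [1^L] after at most one step and stay
   there. *)
have to1 L (c : config L) : 5 <= L -> c \in E L ->
    iter 2 (global_rule f) c = uniform L true.
  move=> L_ge5; have L_gt0 : 0 < L by lia.
  have lift_word (m n : nat) (w : config m) :
      iter 2 (global_rule f) w = uniform m true -> tval c = wpow w n ->
      iter 2 (global_rule f) c = uniform L true.
    move=> fw def_c; have := iter_global_rule_wpow f c w n 2 L_gt0 def_c.
    rewrite fw wpow_nseq => eq_c; apply/val_inj/(etrans eq_c); congr nseq.
    by rewrite -(size_tuple c) def_c size_wpow size_tuple.
  have step10 : global_rule f [tuple true; false] = uniform 2 true.
    by apply: cell_inj => [[|[|k]]] // _; rewrite cell_global_rule.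
  have step01 : global_rule f [tuple false; true] = uniform 2 true.
    by apply: cell_inj => [[|[|k]]] // _; rewrite cell_global_rule.
  (* The alternating words again, now on the cycle of length 4, where the words of period 4 land
     after one step. *)
  have step1010 : global_rule f [tuple true; false; true; false] = uniform 4 true.
    by apply: cell_inj => [[|[|[|[|k]]]]] // _; rewrite cell_global_rule.
  have step0101 : global_rule f [tuple false; true; false; true] = uniform 4 true.
    by apply: cell_inj => [[|[|[|[|k]]]]] // _; rewrite cell_global_rule.
  (* The neighbourhoods met here are 00110, 01100, 11001 and 10011, with values 1, 0, 1, 0 by C3 and
     C4; the next three words are rotations of this one. *)
  have step1100 : global_rule f [tuple true; true; false; false]
                = [tuple true; false; true; false].
    by apply: cell_inj => [[|[|[|[|k]]]]] // _; rewrite cell_global_rule.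
  have step1001 : global_rule f [tuple true; false; false; true]
                = [tuple false; true; false; true].
    by apply: cell_inj => [[|[|[|[|k]]]]] // _; rewrite cell_global_rule.
  have step0011 : global_rule f [tuple false; false; true; true]
                = [tuple true; false; true; false].
    by apply: cell_inj => [[|[|[|[|k]]]]] // _; rewrite cell_global_rule.
  have step0110 : global_rule f [tuple false; true; true; false]
                = [tuple false; true; false; true].
    by apply: cell_inj => [[|[|[|[|k]]]]] // _; rewrite cell_global_rule.
  have one n : tval c = wpow [:: true] n ->
      iter 2 (global_rule f) c = uniform L true.
    by apply: (lift_word 1 n (uniform 1 true)); rewrite /= !fix1.
  have alt10 n : tval c = wpow [:: true; false] n ->
      iter 2 (global_rule f) c = uniform L true.
    by apply: (lift_word 2 n [tuple true; false]); rewrite /= step10 fix1.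
  have alt01 n : tval c = wpow [:: false; true] n ->
      iter 2 (global_rule f) c = uniform L true.
    by apply: (lift_word 2 n [tuple false; true]); rewrite /= step01 fix1.
  rewrite inE /E_words; case: ifP => _; first by rewrite inE => /eqP /one.
  case: ifP => _; rewrite !inE.
    by case/or3P=> /eqP => [/one|/alt10|/alt01].
  case/or3P=> [/eqP /one|/eqP /alt10|/orP[/eqP /alt01|]] //.
  case/or4P=> /eqP.
  - apply: (lift_word 4 _ [tuple true; true; false; false]).
    by rewrite /= step1100 step1010.
  - apply: (lift_word 4 _ [tuple true; false; false; true]).
    by rewrite /= step1001 step0101.
  - apply: (lift_word 4 _ [tuple false; false; true; true]).
    by rewrite /= step0011 step1010.
  - apply: (lift_word 4 _ [tuple false; true; true; false]).
    by rewrite /= step0110 step0101.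
have to0 L (c : config L) : 5 <= L -> c \notin E L ->
    exists t, iter t (global_rule f) c = uniform L false.
  move=> L_ge5 c_notE; have [i _ grow_i] := C2 L L_ge5.
  have grow (d : config L) j : zero_run d j 3 ->
      zero_run (iter n2 (global_rule f) d) (i + j) 4.
    have L_gt0 : 0 < L by lia.
    (* Offset [0] reduces the start of the given run modulo [L]; offset [i] does the same for its
       image. *)
    move=> /(zero_run_modn d 0) run_d; apply/(zero_run_modn _ i).
    by apply/factor_zero_run/grow_i; [rewrite ltn_mod | apply/factor_zero_run].
  have [j _ /factor_zero_run run_c] := C1 L L_ge5 c c_notE.
  (* After [L] rounds the run has length [L + 3], enough to cover the cycle. *)
  have /zero_run_full full := zero_run_grow _ _ grow L _ _ run_c.
  by exists (L * n2 + n1); rewrite iterD iterM full ?leq_addr.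
split=> [L L_ge5 X|L L_ge5 c].
  have L_gt0 : 0 < L by lia.
  split=> [attX|[] ->]; [|exact/attractor_set1/fix0|exact/attractor_set1/fix1].
  have [/set0Pn[c cX] _ _] := attX.
  (* A single element of [X] decides which fixed point [X] is. *)
  have [cE|/(to0 L c L_ge5)[t c_0]] := boolP (c \in E L).
    by right; apply: (attractor_fixpoint attX cX (to1 L c L_ge5 cE)); apply: fix1.
  by left; apply: (attractor_fixpoint attX cX c_0); apply: fix0.
split=> [[s /set1P c_1]|cE]; last by exists 2; rewrite to1 ?set11.
(* Outside [E L] the orbit would reach both [0^L] and [1^L]. *)
apply/negPn/negP => /(to0 L c L_ge5)[t c_0].
have L_gt0 : 0 < L by lia.
by have := uniform_limit_unique L_gt0 f00000 f11111 c_0 c_1.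
Qed.
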